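(* The second Rogers-Ramanujan identity holds: $$\sum_{n\geq 0}\frac{q^{n(n+1)}}{(q;q)_n} = \frac{1}{(q^2,q^3;q^5)_{\infty}}.$$
   Context: The identity is one of formal power series in $q$. The $q$-Pochhammer symbols are defined for $n\in\mathbb{Z}_{\geq 0}\sqcup\{\infty\}$ by $$(a;q)_n=\prod_{0\leq j<n}(1-aq^j),\qquad (a_1,\dots,a_k;q)_n=(a_1;q)_n\cdots(a_k;q)_n.$$ In particular $(q^2,q^3;q^5)_\infty=\prod_{j\geq 0}(1-q^{5j+2})(1-q^{5j+3})$. *)

(* Defs.v *)
From HB Require Import structures.
From mathcomp Require Import all_boot all_order all_algebra.
From mathcomp Require Import all_classical.
From mathcomp Require Import topology sequences.

Set Implicit Arguments.
Unset Strict Implicit.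
Unset Printing Implicit Defensive.

Import GRing.Theory.

Local Open Scope classical_set_scope.
Local Open Scope ring_scope.

(* The ring R[[q]]; a series is identified with its coefficient sequence.     *)
(* [fps R] is kept apart from [nat -> R], which carries the pointwise product *)
(* and no topology on R.                                                      *)
Definition fps (R : Type) : Type := nat -> R.

Section Ring.
Variable R : comNzRingType.
Implicit Types f g h : fps R.

HB.instance Definition _ := Choice.copy (fps R) (nat -> R).

Definition fps_zero : fps R := fun=> 0.
Definition fps_opp f : fps R := fun n => - f n.
Definition fps_add f g : fps R := fun n => f n + g n.
Definition fps_one : fps R := fun n => (n == 0)%:R.
Definition fps_mul f g : fps R := fun n => \sum_(i < n.+1) f i * g (n - i)%N.

Lemma fps_addA : associative fps_add.
Proof. by move=> f g h; apply/funext => n; apply: addrA. Qed.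

Lemma fps_addC : commutative fps_add.
Proof. by move=> f g; apply/funext => n; apply: addrC. Qed.

Lemma fps_add0 : left_id fps_zero fps_add.
Proof. by move=> f; apply/funext => n; apply: add0r. Qed.

Lemma fps_addN : left_inverse fps_zero fps_opp fps_add.
Proof. by move=> f; apply/funext => n; apply: addNr. Qed.

HB.instance Definition _ :=
  GRing.isZmodule.Build (fps R) fps_addA fps_addC fps_add0 fps_addN.

Definition fps_trunc (N : nat) f : {poly R} := \poly_(i < N) f i.

Lemma fps_mul_trunc N f g n : (n < N)%N ->
  fps_mul f g n = (fps_trunc N f * fps_trunc N g)`_n.
Proof.
move=> ltnN; rewrite coefM; apply: eq_bigr => i _.
rewrite !coef_poly (leq_ltn_trans (leq_subr i n) ltnN).
by rewrite (leq_ltn_trans _ ltnN) // -ltnS.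
Qed.

Lemma fps_mulC : commutative fps_mul.
Proof.
by move=> f g; apply/funext => n; rewrite !(@fps_mul_trunc n.+1) // mulrC.
Qed.

Lemma fps_mulA : associative fps_mul.
Proof.
move=> f g h; apply/funext => n.
transitivity ((fps_trunc n.+1 f * (fps_trunc n.+1 g * fps_trunc n.+1 h))`_n).
  rewrite coefM; apply: eq_bigr => i _; rewrite coef_poly ltn_ord.
  by rewrite -fps_mul_trunc // ltnS leq_subr.
rewrite mulrA coefM; apply: eq_bigr => i _.
by rewrite coef_poly ltnS leq_subr -fps_mul_trunc.
Qed.

Lemma fps_mul1 : left_id fps_one fps_mul.
Proof.
move=> f; apply/funext => n; rewrite /fps_mul big_ord_recl /= subn0 mul1r.
by rewrite big1 ?addr0 // => i _; rewrite mul0r.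
Qed.

Lemma fps_mulDl : left_distributive fps_mul fps_add.
Proof.
move=> f g h; apply/funext => n; rewrite /fps_add /fps_mul -big_split /=.
by apply: eq_bigr => i _; rewrite mulrDl.
Qed.

Lemma fps_one_neq0 : fps_one != 0.
Proof. by apply/eqP => /(congr1 (fun f : fps R => f 0)) /eqP; rewrite oner_eq0. Qed.

HB.instance Definition _ := GRing.Zmodule_isComNzRing.Build (fps R)
  fps_mulA fps_mulC fps_mul1 fps_mulDl fps_one_neq0.

Definition fps_unit : {pred fps R} := fun f => `[< exists g : fps R, g * f = 1 >].

(* The inverse of f if f is invertible, f itself otherwise. *)
Definition fps_inv f : fps R := xget f [set g : fps R | g * f = 1].

Lemma fps_mulV : {in fps_unit, left_inverse 1 fps_inv *%R}.
Proof. by move=> f /asboolP; exact: (@xgetPex _ f [set g : fps R | g * f = 1]). Qed.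

Lemma fps_unitPl f g : g * f = 1 -> fps_unit f.
Proof. by move=> gf1; apply/asboolP; exists g. Qed.

Lemma fps_inv_out : {in [predC fps_unit], fps_inv =1 id}.
Proof.
move=> f /asboolPn nf; rewrite /fps_inv; case: xgetP => // g _ gf1.
by case: nf; exists g.
Qed.

HB.instance Definition _ := GRing.ComNzRing_hasMulInverse.Build (fps R)
  fps_mulV fps_unitPl fps_inv_out.

HB.instance Definition _ := isPointed.Build (fps R) 0.

(* The q-adic topology is the product of the discrete topologies on the       *)
(* coefficients.                                                              *)
HB.instance Definition _ :=
  Topological.copy (fps R) (prod_topology (fun _ : nat => discrete_topology R)).

Lemma fps_cvgP (u : nat -> fps R) f :
  u @ \oo --> f <-> forall n : nat, \forall k \near \oo, u k n = f n.
Proof.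
split=> [uf n|uf].
  have pf : continuous (fun g : fps R => (g n : discrete_topology R)).
    exact: (@proj_continuous nat (fun=> discrete_topology R) n).
  have := cvg_comp _ _ uf (pf f); move=> /(_ [set f n]); apply.
  exact/principal_filterP.
apply/(@cvg_sup (fps R) nat (fun i => Topological.class
    (initial_topology (fun g : fps R => g i : discrete_topology R)))) => n.
move=> A [B [[C oC <-] Cf] BA] /=.
by apply: filterS (uf n) => k ukf; apply: BA; rewrite /= ukf.
Qed.

Lemma fps_hausdorff : hausdorff_space (fps R).
Proof.
apply: (@hausdorff_product nat (fun=> discrete_topology R)) => i.
exact: discrete_hausdorff.
Qed.

(* The indeterminate q *)
Definition fps_var : fps R := fun n => (n == 1)%:R.

(* (a; q)_n for finite n *)
Definition qpoch (a q : fps R) (n : nat) : fps R :=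
  \prod_(0 <= j < n) (1 - a * q ^+ j).

(* (a; q)_oo; meaningful only when the finite products converge *)
Definition qpochoo (a q : fps R) : fps R :=
  \big[*%R/1]_(0 <= j <oo) (1 - a * q ^+ j).

(* (a_1, ..., a_k; q)_oo *)
Definition qpochsoo (s : seq (fps R)) (q : fps R) : fps R :=
  \prod_(a <- s) qpochoo a q.

End Ring.

Notation "{ 'fps' R }" := (fps R) (format "{ 'fps'  R }") : type_scope.

(* Main.v *)
Require Import Defs.
From mathcomp Require Import all_boot all_order all_algebra.
From mathcomp Require Import all_classical.
From mathcomp Require Import topology sequences.
From mathcomp Require Import ring zify.

Import GRing.Theory.

Local Open Scope classical_set_scope.
Local Open Scope ring_scope.

(** Everything is proved for finite sums, and only the last step lets their
    length L grow.  Write i(n) = 1 / (Q; Q)_n.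

    The finite Jacobi triple product [finite_jtp], for u w = Q, folds into
    [folded_jtp]:
      (u; Q)_(m+1) (w; Q)_m i(2m+1)
        = sum_(r <= m) (-w)^r Q^C(r,2) (1 - u^(2r+1)) i(m-r) i(m+r+1).
    It is used twice.  With Q = u = q and w = 1 the left-hand side vanishes
    unless m = 0, which gives the unit Bailey pair relative to q.  Applying the
    Bailey lemma ([bailey_lemma], a consequence of the q-Chu-Vandermonde sum
    [q_vandermonde]) twice to this pair yields [finite_rogers_ramanujan]:
      sum_(s <= L) q^(s(s+1)) i(s) i(L-s)
        = sum_(r <= L) (-1)^r q^(2r(r+1) + C(r,2)) (1 - q^(2r+1))
                       i(L-r) i(L+r+1).
    With Q = q^5, u = q, w = q^4 the coefficients in [folded_jtp] become the
    same (-1)^r q^(2r(r+1) + C(r,2)) (1 - q^(2r+1)), because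
    4r + 5 C(r,2) = 2r(r+1) + C(r,2).

    As L tends to infinity, the factors i(L-r), i(L+r+1) tend to 1 / (q; q)_oo
    or 1 / (q^5; q^5)_oo.  With A the sum of these coefficients, the first
    identity says that the Rogers-Ramanujan sum is A / (q; q)_oo, the second
    that A = (q, q^4, q^5; q^5)_oo; splitting (q; q)_oo into residue classes
    modulo 5 leaves 1 / (q^2, q^3; q^5)_oo.

    The limits are taken q-adically with an explicit rate: each finite
    expression of length L agrees with its limit modulo q^L.  The r-th summand
    carries a factor q^r, so that an error modulo q^(L-r) in its cofactor
    suffices ([eqmod_sum_tail]), and no interchange of limits is needed. *)

(** * Congruences modulo powers of q *)

Section Congruence.
Set Implicit Arguments.
Unset Strict Implicit.
Context {R : comNzRingType}.
Implicit Types f g h : {fps R}.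
Local Notation q := (fps_var R).

(** Congruence modulo q^M.  Being an equality of polynomials, it is at once an
    equivalence relation and compatible with products. *)
Definition eqmod (M : nat) f g := fps_trunc M f = fps_trunc M g.

Lemma eqmodP M f g : eqmod M f g <-> (forall n, (n < M)%N -> f n = g n).
Proof.
split=> [fg n nM|fg].
  by have := congr1 (fun p : {poly R} => p`_n) fg; rewrite !coef_poly nM.
by apply/polyP => n; rewrite !coef_poly; case: ifP => // /fg.
Qed.

Lemma eqmod_trans M f g h : eqmod M f g -> eqmod M g h -> eqmod M f h.
Proof. exact: etrans. Qed.

Lemma eqmod_sym M f g : eqmod M f g -> eqmod M g f.
Proof. exact: esym. Qed.

Lemma eqmodW M N f g : (M <= N)%N -> eqmod N f g -> eqmod M f g.
Proof.
by move=> MN /eqmodP fg; apply/eqmodP => n nM; apply: fg; apply: leq_trans MN.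
Qed.

Lemma eqmod_eq f g : (forall M, eqmod M f g) -> f = g.
Proof. by move=> fg; apply/funext => n; have /eqmodP := fg n.+1; apply. Qed.

Lemma fps_mulE f g n : (f * g) n = \sum_(i < n.+1) f i * g (n - i)%N.
Proof. by []. Qed.

Lemma eqmodM M f f' g g' :
  eqmod M f f' -> eqmod M g g' -> eqmod M (f * g) (f' * g').
Proof.
move=> ff' gg'; apply/eqmodP => n nM.
have mulE (a b : {fps R}) : (a * b) n = (fps_trunc M a * fps_trunc M b)`_n.
  exact: (fps_mul_trunc a b nM).
by rewrite !mulE ff' gg'.
Qed.

Lemma eqmodMl M h f g : eqmod M f g -> eqmod M (h * f) (h * g).
Proof. exact: eqmodM. Qed.

Lemma eqmodMr M h f g : eqmod M f g -> eqmod M (f * h) (g * h).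
Proof. by move=> fg; apply: eqmodM. Qed.

Lemma eqmodD M f f' g g' :
  eqmod M f f' -> eqmod M g g' -> eqmod M (f + g) (f' + g').
Proof.
move=> /eqmodP ff' /eqmodP gg'; apply/eqmodP => n nM.
by rewrite /GRing.add /= /fps_add ff' ?gg'.
Qed.

Lemma eqmod_sum M (n : nat) (F G : 'I_n -> {fps R}) :
  (forall i, eqmod M (F i) (G i)) -> eqmod M (\sum_i F i) (\sum_i G i).
Proof. by move=> FG; elim/big_ind2 : _ => // *; apply: eqmodD. Qed.

(** Multiply the congruence by the unit 1 / (f g). *)
Lemma eqmodV M f g : f \is a GRing.unit -> g \is a GRing.unit ->
  eqmod M f g -> eqmod M f^-1 g^-1.
Proof.
move=> fU gU /(eqmodMl (f^-1 * g^-1)) /eqmod_sym.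
by rewrite mulrVK // mulrAC mulVr // mul1r.
Qed.

Lemma coef_varM f n : (q * f) n = if n is n'.+1 then f n' else 0.
Proof.
rewrite fps_mulE; case: n => [|n].
  by rewrite big_ord_recl big_ord0 /fps_var /= mul0r addr0.
rewrite 2!big_ord_recl /fps_var /= mul0r add0r mul1r /bump /= subn1 /=.
by rewrite big1 ?addr0 // => i _; rewrite mul0r.
Qed.

Lemma coef_varXM k f n : (k <= n)%N -> (q ^+ k * f) n = f (n - k)%N.
Proof.
elim: k n => [|k IH] n; first by rewrite mul1r subn0.
by case: n => // n kn; rewrite exprS -mulrA coef_varM IH.
Qed.

Lemma coef_varXM_lt k f n : (n < k)%N -> (q ^+ k * f) n = 0.
Proof.
elim: k n => [//|k IH] [|n] kn; rewrite exprS -mulrA coef_varM //.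
exact: IH.
Qed.

Lemma eqmod_varXM k M f g :
  eqmod (M - k) f g -> eqmod M (q ^+ k * f) (q ^+ k * g).
Proof.
move=> /eqmodP fg; apply/eqmodP => n nM.
have [kn|nk] := leqP k n; last by rewrite !coef_varXM_lt.
by rewrite !coef_varXM // fg //; lia.
Qed.

Lemma eqmod_addX k f g : eqmod k (f + q ^+ k * g) f.
Proof.
apply/eqmodP => n nk.
by rewrite /GRing.add /= /fps_add coef_varXM_lt ?addr0.
Qed.

(** A sequence that is q-adically Cauchy with rate q^n converges at the same
    rate: its coefficient of q^n no longer changes from index n + 1 on. *)
Lemma eqmod_lim (u : nat -> {fps R}) :
  (forall n, eqmod n (u n.+1) (u n)) -> exists f, forall n, eqmod n (u n) f.
Proof.
move=> uS; exists (fun n => u n.+1 n) => n; apply/eqmodP => k.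
elim: n => [//|n IH]; rewrite ltnS leq_eqVlt => /orP[/eqP -> //|kn].
by have /eqmodP -> := uS n; rewrite // IH.
Qed.

Lemma eqmod_cvg (u : nat -> {fps R}) f :
  (forall n, eqmod n (u n) f) -> u @ \oo --> f.
Proof.
move=> uf; apply/fps_cvgP => n; exists n.+1 => // k.
by have /eqmodP := uf k; apply.
Qed.

Lemma eqmod_cvgn (u : nat -> {fps R}) f : (forall n, eqmod n (u n) f) -> cvgn u.
Proof. by move=> /eqmod_cvg uf; apply/cvg_ex; exists f. Qed.

Lemma eqmod_limn (u : nat -> {fps R}) f :
  (forall n, eqmod n (u n) f) -> limn u = f.
Proof. by move=> /eqmod_cvg; apply: cvg_lim; exact: fps_hausdorff. Qed.

(** The inverse of 1 - q e is the limit of the geometric sums of q e. *)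
Lemma fps_unitP f : eqmod 1 f 1 -> f \is a GRing.unit.
Proof.
move=> /eqmodP f1; pose e : {fps R} := fun n => - f n.+1.
have fE : f = 1 - q * e.
  apply/funext => -[|n]; rewrite /GRing.add /GRing.opp /= /fps_add /fps_opp coef_varM.
    by rewrite f1 // oppr0 addr0.
  by rewrite opprK [X in X + _]/(0) add0r.
have gS n : eqmod n (\sum_(k < n.+1) (q * e) ^+ k) (\sum_(k < n) (q * e) ^+ k).
  by rewrite big_ord_recr /= exprMn; exact: eqmod_addX.
have [g gP] := eqmod_lim gS.
suff gf1 : g * f = 1 by apply/unitrP; exists g; rewrite [f * g]mulrC.
apply: eqmod_eq => n.
apply: eqmod_trans (eqmodMr f (eqmod_sym (gP n))) _.
have -> : (\sum_(k < n) (q * e) ^+ k) * f = 1 + q ^+ n * (- e ^+ n).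
  by rewrite fE mulrC -[1 - q * e]opprB mulNr -subrX1 opprB exprMn mulrN.
exact: eqmod_addX.
Qed.

End Congruence.

(** * Finite identities in base Q *)

Section Finite.
Set Implicit Arguments.
Unset Strict Implicit.
Context {R : comNzRingType}.
Variable Q : {fps R}.
Hypothesis Qunit : forall n, qpoch Q Q n \is a GRing.unit.
Implicit Types u w : {fps R}.

Lemma qpoch0 u : qpoch u Q 0 = 1.
Proof. by rewrite /qpoch big_geq. Qed.

Lemma qpochS u n : qpoch u Q n.+1 = qpoch u Q n * (1 - u * Q ^+ n).
Proof. by rewrite /qpoch big_nat_recr. Qed.

Definition qinv n : {fps R} := (qpoch Q Q n)^-1.

Lemma qinv0 : qinv 0 = 1.
Proof. by rewrite /qinv qpoch0 invr1. Qed.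

Lemma unit_1subX n : 1 - Q ^+ n.+1 \is a GRing.unit.
Proof. by have := Qunit n.+1; rewrite qpochS unitrM -exprS => /andP[]. Qed.

Lemma qinvS n : (1 - Q ^+ n.+1) * qinv n.+1 = qinv n.
Proof.
by rewrite /qinv qpochS -exprS invrM ?unit_1subX // mulVKr // unit_1subX.
Qed.

(** The q-Pascal rule for sums against Q-binomial coefficients normalised as
    i(k) i(n-k).  Splitting 1 - Q^(n+1) as
    (1 - Q^(n+1-k)) + Q^(n+1-k) (1 - Q^k) lowers the index of one of the two
    factors in each part; the two extreme terms vanish because 1 - Q^0 = 0. *)
Lemma pascal_sum (F : nat -> {fps R}) n :
  (1 - Q ^+ n.+1) * \sum_(k < n.+2) F k * qinv k * qinv (n.+1 - k) =
  \sum_(k < n.+1) (F k + Q ^+ (n - k) * F k.+1) * qinv k * qinv (n - k).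
Proof.
have -> : (1 - Q ^+ n.+1) * \sum_(k < n.+2) F k * qinv k * qinv (n.+1 - k) =
    \sum_(k < n.+2) F k * qinv k * ((1 - Q ^+ (n.+1 - k)) * qinv (n.+1 - k)) +
    \sum_(k < n.+2)
      Q ^+ (n.+1 - k) * F k * ((1 - Q ^+ k) * qinv k) * qinv (n.+1 - k).
  rewrite mulr_sumr -big_split /=; apply: eq_bigr => k _.
  have -> : Q ^+ n.+1 = Q ^+ (n.+1 - k) * Q ^+ k.
    by rewrite -exprD subnK // -ltnS.
  by ring.
rewrite big_ord_recr [X in _ + X = _]big_ord_recl /= subnn expr0 subrr.
rewrite !(mul0r, mulr0) addr0 add0r -big_split /=; apply: eq_bigr => k _.
by rewrite /bump /= add1n subSS qinvS subSn -1?ltnS // qinvS; ring.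
Qed.

(** The other q-Pascal rule, obtained by reversing the order of summation. *)
Lemma pascal_sum_rev (F : nat -> {fps R}) n :
  (1 - Q ^+ n.+1) * \sum_(k < n.+2) F k * qinv k * qinv (n.+1 - k) =
  \sum_(k < n.+1) (F k.+1 + Q ^+ k * F k) * qinv k * qinv (n - k).
Proof.
have := pascal_sum (fun k => F (n.+1 - k)%N) n.
rewrite (reindex_inj rev_ord_inj) /= => E.
rewrite [RHS](reindex_inj rev_ord_inj) /=.
transitivity ((1 - Q ^+ n.+1) * \sum_(j < n.+2)
   F (n.+1 - (n.+2 - j.+1))%N * qinv (n.+2 - j.+1) * qinv (n.+1 - (n.+2 - j.+1))).
  congr (_ * _); apply: eq_bigr => -[j /= jlt] _.
  by rewrite !subSS subKn // mulrAC.
rewrite E; apply: eq_bigr => -[j /= jlt] _.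
by rewrite !subSS subKn // subSn // mulrAC.
Qed.

(** With j = k - n this is (-u)^j Q^(j(j-1)/2) for every integer j >= -n, once
    u^(-1) is replaced by w / Q; truncated subtraction makes either the powers
    of u or those of w trivial, so no negative exponent occurs. *)
Definition jtp_term u w n k : {fps R} :=
  (- u) ^+ (k - n) * (- w) ^+ (n - k) * Q ^+ ('C(k - n, 2) + 'C(n - k, 2)).

Definition jtp_sum u w m n : {fps R} :=
  \sum_(k < (m + n).+1) jtp_term u w n k * qinv k * qinv (m + n - k).

Lemma jtp_termS u w m n k : u * w = Q -> (k <= m + n)%N ->
  Q ^+ (m + n - k) * jtp_term u w n k.+1 = - u * Q ^+ m * jtp_term u w n k.
Proof.
move=> uwQ kmn; have [nk|kn] := leqP n k.
  have [j kE] : exists j, k = (n + j)%N by exists (k - n)%N; lia.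
  have [i mE] : exists i, m = (i + j)%N by exists (m - j)%N; lia.
  rewrite /jtp_term; have -> : (n - k.+1 = 0)%N by lia.
  have -> : (n - k = 0)%N by lia.
  have -> : (k.+1 - n = j.+1)%N by lia.
  have -> : (k - n = j)%N by lia.
  have -> : (m + n - k = i)%N by lia.
  by rewrite mE binS bin1 !addn0 !exprD exprS; ring.
have [r nE] : exists r, n = (k + r.+1)%N by exists (n - k.+1)%N; lia.
rewrite /jtp_term; have -> : (k.+1 - n = 0)%N by lia.
have -> : (k - n = 0)%N by lia.
have -> : (n - k.+1 = r)%N by lia.
have -> : (n - k = r.+1)%N by lia.
have -> : (m + n - k = m + r.+1)%N by lia.
by rewrite binS bin1 !add0n !exprD !exprS -{2}uwQ; ring.
Qed.

(** By the q-Pascal rule and [jtp_termS], raising m multiplies each summand by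
    the same factor. *)
Lemma jtp_sumS u w m n : u * w = Q ->
  (1 - Q ^+ (m + n).+1) * jtp_sum u w m.+1 n =
  (1 - u * Q ^+ m) * jtp_sum u w m n.
Proof.
move=> uwQ; rewrite /jtp_sum addSn pascal_sum mulr_sumr.
apply: eq_bigr => -[k /= klt] _; rewrite jtp_termS //.
by move: (jtp_term u w n k) => t; ring.
Qed.

Lemma jtp_sumC u w m n : jtp_sum u w m n = jtp_sum w u n m.
Proof.
rewrite /jtp_sum (reindex_inj rev_ord_inj) addnC; apply: eq_bigr => -[k /= klt] _.
rewrite subSS subKn // mulrAC; congr (_ * _ * _).
rewrite /jtp_term.
have -> : (n + m - k - n = m - k)%N by lia.
have -> : (n - (n + m - k) = k - m)%N by lia.
by rewrite addnC; ring.
Qed.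

(** Induction on m by [jtp_sumS]; the base m = 0 is, by the symmetry
    [jtp_sumC], the same induction for w started at (0, 0). *)
Lemma finite_jtp u w m n : u * w = Q ->
  qpoch u Q m * qpoch w Q n * qinv (m + n) = jtp_sum u w m n.
Proof.
have step v z i j : v * z = Q ->
    qpoch v Q i * qpoch z Q j * qinv (i + j) = jtp_sum v z i j ->
    qpoch v Q i.+1 * qpoch z Q j * qinv (i.+1 + j) = jtp_sum v z i.+1 j.
  move=> vz E; apply: (mulrI (unit_1subX (i + j))).
  by rewrite jtp_sumS // -E -(qinvS (i + j)) qpochS addSn; ring.
move=> uwQ; elim: m => [|m IH]; last exact: step.
rewrite jtp_sumC [qpoch u Q 0 * _]mulrC addnC.
elim: n => [|n IH]; last by apply: step => //; rewrite // mulrC.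
by rewrite /jtp_sum !qpoch0 big_ord1 qinv0 /jtp_term !mulr1.
Qed.

Lemma sum_fold (F : nat -> {fps R}) m :
  \sum_(k < (m.+1 + m).+1) F k = \sum_(r < m.+1) (F (m - r)%N + F (m + r.+1)%N).
Proof.
rewrite -addnS big_split_ord big_split /=; congr (_ + _).
  by rewrite (reindex_inj rev_ord_inj); apply: eq_bigr => i _.
by apply: eq_bigr => i _; rewrite addnS.
Qed.

(** When one product has one more factor than the other, the summands of
    [finite_jtp] with exponents j = -r and j = r + 1 have equal Q-binomial
    weights and combine. *)
Lemma folded_jtp u w m : u * w = Q ->
  qpoch u Q m.+1 * qpoch w Q m * qinv (m.+1 + m) =
  \sum_(r < m.+1) (- w) ^+ r * Q ^+ 'C(r, 2) * (1 - u ^+ (2 * r).+1)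
                  * qinv (m - r) * qinv (m + r.+1).
Proof.
move=> uwQ; rewrite finite_jtp // /jtp_sum.
rewrite (sum_fold (fun k => jtp_term u w m k * qinv k * qinv (m.+1 + m - k))).
apply: eq_bigr => -[r /= rm] _.
have -> : (m.+1 + m - (m - r) = m + r.+1)%N by lia.
have -> : (m.+1 + m - (m + r.+1) = m - r)%N by lia.
rewrite /jtp_term.
have -> : (m - r - m = 0)%N by lia.
have -> : (m - (m - r) = r)%N by lia.
have -> : (m + r.+1 - m = r.+1)%N by lia.
have -> : (m - (m + r.+1) = 0)%N by lia.
rewrite binS bin1 !addn0 add0n exprD.
have -> : Q ^+ r = u ^+ r * w ^+ r by rewrite -exprMn uwQ.
rewrite (exprS u (2 * r)) mulnC exprM expr2 exprS (exprNn u r) (exprNn w r).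
by ring.
Qed.

(** By the q-Pascal rule, multiplying the sum for (n + 1, c) by 1 - Q^(n+1)
    gives the sum for (n, c + 1). *)
Lemma q_vandermonde n c :
  \sum_(k < n.+1) Q ^+ (k * (k + c)) * qinv (k + c) * qinv k * qinv (n - k) =
  qinv n * qinv (n + c).
Proof.
elim: n c => [|n IH] c.
  by rewrite big_ord1 /= qinv0 mul0n expr0 !mul1r !mulr1.
apply: (mulrI (unit_1subX n)).
rewrite (pascal_sum_rev (fun k => Q ^+ (k * (k + c)) * qinv (k + c))).
rewrite mulrA qinvS addSnnS -IH; apply: eq_bigr => k _; congr (_ * _ * _).
rewrite -[qinv (k + c)]qinvS -addnS -addSnnS.
have -> : (k.+1 * (k.+1 + c) = k * (k.+1 + c) + (k + c).+1)%N by lia.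
have -> : (k * (k.+1 + c) = k * (k + c) + k)%N by lia.
by rewrite !exprD addSn; ring.
Qed.

(** A Bailey pair relative to a = Q, up to the factor 1 - Q in the usual
    normalisation: there 1 / (a Q; Q)_(L+r) = (1 - Q) i(L+r+1). *)
Definition bailey_pair (alpha beta : nat -> {fps R}) :=
  forall L,
    beta L = \sum_(r < L.+1) alpha r * qinv (L - r) * qinv (L + r.+1).

(** [folded_jtp] at u = Q, w = 1: the product (1; Q)_L is zero for L > 0. *)
Lemma unit_bailey_pair :
  bailey_pair (fun r => (-1) ^+ r * Q ^+ 'C(r, 2) * (1 - Q ^+ (2 * r).+1))
              (fun L => (L == 0)%:R).
Proof.
move=> L; rewrite -folded_jtp ?mulr1 //.
case: L => [|L] /=; first by rewrite qpoch0 mulr1 mulrV ?Qunit.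
by rewrite [qpoch 1 Q _]big_ltn // mul1r subrr mul0r mulr0 mul0r.
Qed.

Lemma triangular_sum (f : nat -> nat -> {fps R}) L :
  \sum_(s < L.+1) \sum_(r < s.+1) f s r =
  \sum_(r < L.+1) \sum_(k < (L - r).+1) f (k + r)%N r.
Proof.
elim: L => [|L IH]; first by rewrite !big_ord1.
rewrite big_ord_recr /= IH [RHS]big_ord_recr /= subnn big_ord1 add0n.
rewrite [X in _ + X]big_ord_recr /= addrA; congr (_ + _).
rewrite -big_split; apply: eq_bigr => -[r /= rL] _.
by rewrite subSn // [RHS]big_ord_recr /= -subSn // subnK // ltnW.
Qed.

(** Insert the definition of beta and exchange the sums; the inner sum over
    s = r + k is [q_vandermonde] with n = L - r and c = 2r + 1. *)
Lemma bailey_lemma alpha beta : bailey_pair alpha beta ->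
  bailey_pair (fun r => Q ^+ (r * (r + 1)) * alpha r)
    (fun L => \sum_(s < L.+1) Q ^+ (s * (s + 1)) * beta s * qinv (L - s)).
Proof.
move=> ab L; transitivity (\sum_(s < L.+1) \sum_(r < s.+1)
    Q ^+ (s * (s + 1)) * alpha r * qinv (s - r) * qinv (s + r.+1) * qinv (L - s)).
  apply: eq_bigr => s _; rewrite ab mulr_sumr mulr_suml.
  by apply: eq_bigr => r _; rewrite !mulrA.
rewrite (triangular_sum (fun s r =>
  Q ^+ (s * (s + 1)) * alpha r * qinv (s - r) * qinv (s + r.+1) * qinv (L - s))).
apply: eq_bigr => -[r /= rL] _.
have -> : (L + r.+1 = L - r + (2 * r).+1)%N by lia.
rewrite -mulrA -q_vandermonde mulr_sumr; apply: eq_bigr => -[k /= kL] _.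
have -> : (k + r - r = k)%N by lia.
have -> : (k + r + r.+1 = k + (2 * r).+1)%N by lia.
have -> : (L - (k + r) = L - r - k)%N by lia.
have -> : ((k + r) * (k + r + 1) = r * (r + 1) + k * (k + (2 * r).+1))%N by lia.
by rewrite exprD; ring.
Qed.

(** The first application of the Bailey lemma to the unit pair turns beta into
    i(L), the second into the left-hand side. *)
Lemma finite_rogers_ramanujan L :
  \sum_(s < L.+1) Q ^+ (s * (s + 1)) * qinv s * qinv (L - s) =
  \sum_(r < L.+1) Q ^+ (r * (r + 1)) * (Q ^+ (r * (r + 1)) *
    ((-1) ^+ r * Q ^+ 'C(r, 2) * (1 - Q ^+ (2 * r).+1)))
    * qinv (L - r) * qinv (L + r.+1).
Proof.
rewrite -(bailey_lemma (bailey_lemma unit_bailey_pair)).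
apply: eq_bigr => s _; rewrite big_ord_recl /= mul0n expr0 !mul1r subn0.
by rewrite big1 ?addr0 // => i _; rewrite mulr0 mul0r.
Qed.

End Finite.

(** * Passage to the limit *)

Section Limit.
Set Implicit Arguments.
Unset Strict Implicit.
Context {R : comNzRingType}.
Local Notation q := (fps_var R).
Implicit Types c d n L : nat.

Lemma unit_1subqM (f : {fps R}) : 1 - q * f \is a GRing.unit.
Proof. by apply: fps_unitP; rewrite -mulrN; exact: (@eqmod_addX _ 1). Qed.

(** Exponents c + 1 and d + 1 make both parameters multiples of q, so that the
    products have constant term 1 and converge. *)
Lemma qpoch_unit c d n : qpoch (q ^+ c.+1) (q ^+ d.+1) n \is a GRing.unit.
Proof.
rewrite /qpoch; elim/big_ind: _ => [|f g fU gU|j _]; first exact: unitr1.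
  by rewrite unitrM fU.
by rewrite exprS -mulrA unit_1subqM.
Qed.

Lemma qpoch_eqmodS c d n :
  eqmod n (qpoch (q ^+ c.+1) (q ^+ d.+1) n.+1) (qpoch (q ^+ c.+1) (q ^+ d.+1) n).
Proof.
rewrite qpochS mulrBr mulr1 -exprM -exprD.
have -> : (c.+1 + d.+1 * n = n + (c.+1 + d * n))%N by lia.
by rewrite exprD mulrCA -mulrN; exact: eqmod_addX.
Qed.

Lemma qpochooP c d n :
  eqmod n (qpoch (q ^+ c.+1) (q ^+ d.+1) n) (qpochoo (q ^+ c.+1) (q ^+ d.+1)).
Proof.
have [f fP] := eqmod_lim (qpoch_eqmodS c d).
by rewrite /qpochoo (eqmod_limn fP); exact: fP.
Qed.

Lemma qpochoo_unit c d : qpochoo (q ^+ c.+1) (q ^+ d.+1) \is a GRing.unit.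
Proof.
apply: fps_unitP; apply: eqmod_trans (eqmod_sym (qpochooP c d 1)) _.
rewrite qpochS qpoch0 mul1r expr0 mulr1 exprS -mulrN.
exact: (@eqmod_addX _ 1).
Qed.

Lemma qinv_eqmod d n N : (n <= N)%N ->
  eqmod n (qinv (q ^+ d.+1) N) (qpochoo (q ^+ d.+1) (q ^+ d.+1))^-1.
Proof.
move=> nN; apply: eqmodV; [exact: qpoch_unit | exact: qpochoo_unit |].
exact: eqmodW nN (qpochooP _ _ _).
Qed.

(** A q-adic Tannery theorem: the factor q^s makes up for the loss of accuracy
    of v s. *)
Lemma eqmod_sum_tail (c v : nat -> {fps R}) v0 L :
  (forall s, eqmod (L - s) (v s) v0) ->
  eqmod L (\sum_(s < L.+1) q ^+ s * c s * v s)
          ((\sum_(s < L.+1) q ^+ s * c s) * v0).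
Proof.
move=> vP; rewrite mulr_suml; apply: eqmod_sum => s.
by rewrite -!mulrA; apply: eqmod_varXM; exact/eqmodMl/vP.
Qed.

(** The first 5 n factors of (q; q)_oo, sorted by residue modulo 5. *)
Lemma qpochoo_dissection :
  qpochoo q q = \prod_(i < 5) qpochoo (q ^+ i.+1) (q ^+ 5).
Proof.
have fin n : qpoch q q (5 * n) = \prod_(i < 5) qpoch (q ^+ i.+1) (q ^+ 5) n.
  elim: n => [|n IH]; first by rewrite big1 ?qpoch0 // => i _; rewrite qpoch0.
  under [RHS]eq_bigr do rewrite qpochS.
  rewrite big_split mulnS !qpochS IH -!mulrA; congr (_ * _).
  by rewrite !big_ord_recl big_ord0 -!exprM /= !exprS !exprD; ring.
apply: eqmod_eq => n.
apply: eqmod_trans (eqmod_sym (_ : eqmod n (qpoch q q (5 * n)) _)) _.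
  by apply: (@eqmodW _ n (5 * n)); [lia | exact: (@qpochooP 0 0)].
rewrite fin; elim/big_ind2: _ => // [f f' g g'|i _]; first exact: eqmodM.
exact: qpochooP.
Qed.

(** q^r times this is the coefficient (-1)^r q^(2r(r+1) + C(r,2)) (1 - q^(2r+1))
    shared by the two finite identities; the factor q^r is split off for
    [eqmod_sum_tail]. *)
Definition rr_term r : {fps R} :=
  q ^+ (r * r) * (q ^+ (r * (r + 1)) *
    ((-1) ^+ r * q ^+ 'C(r, 2) * (1 - q ^+ (2 * r).+1))).

(** The limit of [finite_rogers_ramanujan], multiplied by (q; q)_oo. *)
Lemma rogers_ramanujan_sum L :
  eqmod L (\sum_(s < L) q ^+ (s * (s + 1)) / qpoch q q s)
          ((\sum_(r < L.+1) q ^+ r * rr_term r) / qpochoo q q).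
Proof.
have qU n : qpoch q q n \is a GRing.unit by exact: (qpoch_unit 0 0).
have PU : qpochoo q q \is a GRing.unit by exact: (qpochoo_unit 0 0).
have qX r : q ^+ (r * (r + 1)) = q ^+ r * q ^+ (r * r).
  by rewrite -exprD; congr (_ ^+ _); lia.
have iP n N : (n <= N)%N -> eqmod n (qinv q N) (qpochoo q q)^-1.
  exact: (@qinv_eqmod 0).
(* One more term changes the sum only by a multiple of q^L. *)
pose S := \sum_(s < L.+1) q ^+ (s * (s + 1)) * qinv q s.
apply: (@eqmod_trans _ _ _ S).
  apply: eqmod_sym; rewrite /S big_ord_recr /= qX -!mulrA; exact: eqmod_addX.
have SE : S = \sum_(s < L.+1) q ^+ s * (q ^+ (s * s) * qinv q s).
  by apply: eq_bigr => s _; rewrite qX mulrA.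
have SP : eqmod L (\sum_(s < L.+1) q ^+ (s * (s + 1)) * qinv q s * qinv q (L - s))
                   (S / qpochoo q q).
  rewrite SE; under eq_bigr do rewrite qX -(mulrA (q ^+ _) (q ^+ _)).
  apply: (@eqmod_sum_tail (fun s => q ^+ (s * s) * qinv q s)
                          (fun s => qinv q (L - s))) => s.
  exact: iP.
rewrite finite_rogers_ramanujan // in SP.
have AP : eqmod L (\sum_(r < L.+1) q ^+ (r * (r + 1)) * (q ^+ (r * (r + 1)) *
      ((-1) ^+ r * q ^+ 'C(r, 2) * (1 - q ^+ (2 * r).+1)))
      * qinv q (L - r) * qinv q (L + r.+1))
    ((\sum_(r < L.+1) q ^+ r * rr_term r) * ((qpochoo q q)^-1 / qpochoo q q)).
  have -> : \sum_(r < L.+1) q ^+ (r * (r + 1)) * (q ^+ (r * (r + 1)) *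
      ((-1) ^+ r * q ^+ 'C(r, 2) * (1 - q ^+ (2 * r).+1)))
      * qinv q (L - r) * qinv q (L + r.+1) =
    \sum_(r < L.+1) q ^+ r * rr_term r * (qinv q (L - r) * qinv q (L + r.+1)).
    by apply: eq_bigr => r _; rewrite /rr_term !qX; ring.
  apply: (@eqmod_sum_tail rr_term
            (fun r => qinv q (L - r) * qinv q (L + r.+1))) => r.
  by apply: eqmodM; apply: iP => //; lia.
have := eqmodMr (qpochoo q q) (eqmod_trans (eqmod_sym SP) AP).
by rewrite mulrA !mulrVK.
Qed.

(** The limit of [folded_jtp] with Q = q^5, u = q and w = q^4, multiplied by
    the square of (q^5; q^5)_oo. *)
Lemma rogers_ramanujan_product L :
  eqmod L (\sum_(r < L.+1) q ^+ r * rr_term r)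
    (qpochoo q (q ^+ 5) * qpochoo (q ^+ 4) (q ^+ 5) * qpochoo (q ^+ 5) (q ^+ 5)).
Proof.
set Z := qpochoo (q ^+ 5) (q ^+ 5).
have QU n : qpoch (q ^+ 5) (q ^+ 5) n \is a GRing.unit by exact: qpoch_unit.
have ZU : Z \is a GRing.unit by exact: qpochoo_unit.
have iP n N : (n <= N)%N -> eqmod n (qinv (q ^+ 5) N) Z^-1.
  exact: (@qinv_eqmod 4).
have E : eqmod L (qpochoo q (q ^+ 5) * qpochoo (q ^+ 4) (q ^+ 5) / Z)
                 ((\sum_(r < L.+1) q ^+ r * rr_term r) * (Z^-1 / Z)).
  apply: (@eqmod_trans _ _ _ (qpoch q (q ^+ 5) L.+1 * qpoch (q ^+ 4) (q ^+ 5) L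
                              * qinv (q ^+ 5) (L.+1 + L))).
    apply: eqmod_sym; apply: eqmodM; last by apply: iP; lia.
    apply: eqmodM; last exact: qpochooP.
    by apply: (eqmodW (leqnSn L)); exact: (@qpochooP 0).
  rewrite folded_jtp -?exprS //.
  have -> : \sum_(r < L.+1) (- q ^+ 4) ^+ r * (q ^+ 5) ^+ 'C(r, 2) *
        (1 - q ^+ (2 * r).+1) * qinv (q ^+ 5) (L - r) * qinv (q ^+ 5) (L + r.+1) =
      \sum_(r < L.+1) q ^+ r * rr_term r *
        (qinv (q ^+ 5) (L - r) * qinv (q ^+ 5) (L + r.+1)).
    apply: eq_bigr => r _; rewrite mulrA; congr (_ * _ * _).
    rewrite exprNn -!exprM /rr_term.
    transitivity ((-1) ^+ r * q ^+ (4 * r + 5 * 'C(r, 2)) * (1 - q ^+ (2 * r).+1)).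
      by rewrite exprD !mulrA.
    have -> : (4 * r + 5 * 'C(r, 2) = r + r * r + r * (r + 1) + 'C(r, 2))%N.
      have : ('C(r, 2) * 2 + r = r * r)%N.
        by elim: (nat_of_ord r) => [//|k IHk]; rewrite binS bin1; lia.
      by lia.
    by rewrite !exprD; ring.
  apply: (@eqmod_sum_tail rr_term
            (fun r => qinv (q ^+ 5) (L - r) * qinv (q ^+ 5) (L + r.+1))) => r.
  by apply: eqmodM; apply: iP => //; lia.
have := eqmodMr (Z * Z) (eqmod_sym E).
have -> A : A * (Z^-1 / Z) * (Z * Z) = A.
  by rewrite -mulrA mulrACA mulVr // !mulr1.
by rewrite mulrA mulrVK.
Qed.

Lemma rogers_ramanujan L :
  eqmod L (\sum_(s < L) q ^+ (s * (s + 1)) / qpoch q q s)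
          (qpochoo (q ^+ 2) (q ^+ 5) * qpochoo (q ^+ 3) (q ^+ 5))^-1.
Proof.
have PU : qpochoo q q \is a GRing.unit by exact: (qpochoo_unit 0 0).
have VWU : qpochoo (q ^+ 2) (q ^+ 5) * qpochoo (q ^+ 3) (q ^+ 5) \is a GRing.unit.
  by rewrite unitrM !qpochoo_unit.
apply: eqmod_trans (rogers_ramanujan_sum L) _.
apply: eqmod_trans (eqmodMr _ (rogers_ramanujan_product L)) _.
suff -> : (qpochoo (q ^+ 2) (q ^+ 5) * qpochoo (q ^+ 3) (q ^+ 5))^-1 =
  qpochoo q (q ^+ 5) * qpochoo (q ^+ 4) (q ^+ 5) * qpochoo (q ^+ 5) (q ^+ 5)
    / qpochoo q q by [].
apply: (mulIr VWU); rewrite mulVr // mulrAC; apply: (mulIr PU).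
rewrite mulrVK // mul1r qpochoo_dissection !big_ord_recl big_ord0 /=.
by rewrite mulr1; ring.
Qed.

End Limit.

(* The first four conjuncts say that every quotient and every limit in the    *)
(* identity is well defined: division is by invertible series, and the        *)
(* infinite products and the infinite sum converge.                           *)
Theorem mainTheorem1 (R : comNzRingType) :
  let q : {fps R} := fps_var R in
  [/\ forall n : nat, qpoch q q n \is a GRing.unit,
      cvgn (qpoch (q ^+ 2) (q ^+ 5)) /\ cvgn (qpoch (q ^+ 3) (q ^+ 5)),
      qpochsoo [:: q ^+ 2; q ^+ 3] (q ^+ 5) \is a GRing.unit,
      cvgn (fun N : nat => \sum_(0 <= n < N) q ^+ (n * (n + 1)) / qpoch q q n) &
      \big[+%R/0]_(0 <= n <oo) (q ^+ (n * (n + 1)) / qpoch q q n)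
        = 1 / qpochsoo [:: q ^+ 2; q ^+ 3] (q ^+ 5)].
Proof.
move=> q.
have rr L : eqmod L (\sum_(0 <= n < L) q ^+ (n * (n + 1)) / qpoch q q n)
    (1 / qpochsoo [:: q ^+ 2; q ^+ 3] (q ^+ 5)).
  rewrite big_mkord div1r /qpochsoo big_cons big_seq1.
  exact: rogers_ramanujan.
split.
- exact: (qpoch_unit 0 0).
- by split; exact: eqmod_cvgn (qpochooP _ _).
- by rewrite /qpochsoo big_cons big_seq1 unitrM !qpochoo_unit.
- exact: eqmod_cvgn rr.
- exact: eqmod_limn rr.
Qed.
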